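(* Let $L$ be a $\mathbb{Z}$-colorable link with $\mathrm{mincol}_{\mathbb{Z}}(L)=4$. Then there exist a diagram $D$ of $L$ and a $\mathbb{Z}$-coloring $\gamma$ on $D$ such that $\mathrm{Im}(\gamma)=\{0,1,2,3\}$.
   Context: An arc of a regular link diagram $D$ is a maximal unbroken piece of the diagram. A $\mathbb{Z}$-coloring on $D$ is a map $\gamma:\{\text{arcs of } D\}\to\mathbb{Z}$ such that at each crossing with over arc $a$ and under arcs $b,c$ one has $2\gamma(a)=\gamma(b)+\gamma(c)$; it is trivial if all arcs get the same color. A link is $\mathbb{Z}$-colorable if some diagram of it admits a non-trivial $\mathbb{Z}$-coloring. For a $\mathbb{Z}$-colorable link $L$, $\mathrm{mincol}_{\mathbb{Z}}(L)$ is the minimum of $|\mathrm{Im}(\gamma)|$ over all non-trivial $\mathbb{Z}$-colorings $\gamma$ on all diagrams of $L$. *)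

(* Defs.v *)
(* links are tame (polygonal) links in R^3 up to ambient
   isotopy; diagrams are regular projections to the xy-plane. *)
From Stdlib Require Import Reals List ZArith Arith.
Import ListNotations.
Open Scope R_scope.

Definition pt := (R * R * R)%type.
Definition px (p : pt) : R := fst (fst p).
Definition py (p : pt) : R := snd (fst p).
Definition pz (p : pt) : R := snd p.
Definition dist2 (p q : pt) : R :=
  (px p - px q) ^ 2 + (py p - py q) ^ 2 + (pz p - pz q) ^ 2.
Definition near (p q : pt) (e : R) : Prop := dist2 p q < e ^ 2.

Definition comb (s : R) (a b : pt) : pt :=
  ((1 - s) * px a + s * px b, (1 - s) * py a + s * py b, (1 - s) * pz a + s * pz b).
Definition on_seg (a b x : pt) : Prop := exists s, 0 <= s <= 1 /\ x = comb s a b.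
Definition in_open_seg (a b x : pt) : Prop := exists s, 0 < s < 1 /\ x = comb s a b.

(** A link presentation: a list of closed polygons, each a list of vertices. *)
Definition pt0 : pt := (0, 0, 0).
Definition vtx (L : list (list pt)) (c i : nat) : pt := nth i (nth c L []) pt0.
Definition clen (L : list (list pt)) (c : nat) : nat := length (nth c L []).
Definition nxt (L : list (list pt)) (c i : nat) : nat := Nat.modulo (S i) (clen L c).
Definition valid (L : list (list pt)) (c i : nat) : Prop :=
  (c < length L)%nat /\ (i < clen L c)%nat.
Definition on_edge (L : list (list pt)) (c i : nat) (x : pt) : Prop :=
  on_seg (vtx L c i) (vtx L c (nxt L c i)) x.
Definition points (L : list (list pt)) (x : pt) : Prop :=
  exists c i, valid L c i /\ on_edge L c i x.

Definition pl_link (L : list (list pt)) : Prop :=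
  L <> [] /\
  (forall c, (c < length L)%nat -> (3 <= clen L c)%nat) /\
  (forall c i, valid L c i -> vtx L c i <> vtx L c (nxt L c i)) /\
  (forall c i d j x, valid L c i -> valid L d j ->
     on_edge L c i x -> on_edge L d j x ->
     (c = d /\ i = j) \/
     (c = d /\ j = nxt L c i /\ x = vtx L c j) \/
     (c = d /\ i = nxt L c j /\ x = vtx L c i)).

Definition proj (p : pt) : R * R := (px p, py p).

Definition regular (L : list (list pt)) : Prop :=
  (forall x y z, points L x -> points L y -> points L z ->
     proj x = proj y -> proj y = proj z -> x = y \/ y = z \/ x = z) /\
  (forall c i y, valid L c i -> points L y -> proj y = proj (vtx L c i) ->
     y = vtx L c i) /\
  (forall c i d j x y, valid L c i -> valid L d j ->
     on_edge L c i x -> on_edge L d j y -> x <> y -> proj x = proj y ->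
     let a := vtx L c i in let b := vtx L c (nxt L c i) in
     let a' := vtx L d j in let b' := vtx L d (nxt L d j) in
     (px b - px a) * (py b' - py a') - (py b - py a) * (px b' - px a') <> 0).

Definition under (L : list (list pt)) (q : pt) : Prop :=
  points L q /\ exists p, points L p /\ proj p = proj q /\ pz q < pz p.

(** A Z-coloring, viewed as a function on points which is constant on each
    arc (= connected component of the link minus the under-crossing points),
    i.e. locally constant there, and satisfies 2 g(over) = g(under1)+g(under2)
    at every crossing. *)
Definition Zcoloring (L : list (list pt)) (g : pt -> Z) : Prop :=
  (forall x, points L x -> ~ under L x ->
     exists e, 0 < e /\ forall y, points L y -> ~ under L y -> near x y e ->
       g y = g x) /\
  (forall q p, points L q -> points L p -> proj p = proj q -> pz q < pz p ->
     exists e, 0 < e /\ forall x y, points L x -> points L y ->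
       near q x e -> near q y e -> in_open_seg x y q ->
       (2 * g p = g x + g y)%Z).

Definition nontrivial (L : list (list pt)) (g : pt -> Z) : Prop :=
  exists x y, points L x /\ ~ under L x /\ points L y /\ ~ under L y /\ g x <> g y.

Definition image_is (L : list (list pt)) (g : pt -> Z) (s : list Z) : Prop :=
  NoDup s /\ forall z, In z s <-> exists x, points L x /\ ~ under L x /\ g x = z.

Definition cont (f : pt -> pt) : Prop :=
  forall x e, 0 < e -> exists d, 0 < d /\ forall y, near x y d -> near (f x) (f y) e.
Definition cont2 (H : R -> pt -> pt) : Prop :=
  forall t x e, 0 < e -> exists d, 0 < d /\ forall t' y,
    Rabs (t' - t) < d -> near x y d -> near (H t x) (H t' y) e.
Definition homeo (f : pt -> pt) : Prop :=
  exists h, cont f /\ cont h /\ (forall x, h (f x) = x) /\ (forall x, f (h x) = x).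

Definition ambient_isotopic (L1 L2 : list (list pt)) : Prop :=
  exists H : R -> pt -> pt, cont2 H /\ (forall t, homeo (H t)) /\
    (forall x, H 0 x = x) /\
    (forall y, points L2 y <-> exists x, points L1 x /\ H 1 x = y).

Definition diagram_of (L D : list (list pt)) : Prop :=
  pl_link D /\ regular D /\ ambient_isotopic L D.

Definition Zcolorable (L : list (list pt)) : Prop :=
  exists D g, diagram_of L D /\ Zcoloring D g /\ nontrivial D g.

Definition mincolZ_eq (L : list (list pt)) (n : nat) : Prop :=
  (exists D g s, diagram_of L D /\ Zcoloring D g /\ nontrivial D g /\
     image_is D g s /\ length s = n) /\
  (forall D g s, diagram_of L D -> Zcoloring D g -> nontrivial D g ->
     image_is D g s -> (n <= length s)%nat).

(* Main.v *)
Require Import Defs.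
From Stdlib Require Import Reals List ZArith Lra Lia Classical Bool.
Import ListNotations.
Open Scope R_scope.

(** Work on one diagram carrying a coloring with four colors [a < b < c < d].  Composing the
    coloring with a map of colors that respects the progressions [2 o = u + v] occurring among
    them gives a coloring again.  If one of the colors lies in no progression, its indicator
    function is a coloring with two colors, contradicting minimality; so up to an affine map the
    colors are [0,1,2,3], [0,1,2,4] or the mirror image of the latter.

    In the case [0,1,2,4] the parity of the color is constant on each component of the link, and
    no arc colored [1] passes under an even one.  Hence the odd components lie above the even
    ones and the link is split.  Instead of moving the components apart, color the odd ones
    [1] and a point of an even one [0] or [2] according to the parity of the number of times a
    planar ray from that point meets the odd components.  This is a coloring of the same diagram
    with at most three colors, contradicting minimality. *)

(** * Uniform radii and connectedness of the unit interval *)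

Lemma finite_min (P : nat -> R -> Prop) (n : nat) :
  (forall i d d', 0 < d' <= d -> P i d -> P i d') ->
  (forall i, (i < n)%nat -> exists d, 0 < d /\ P i d) ->
  exists d, 0 < d /\ forall i, (i < n)%nat -> P i d.
Proof.
  intros mono; induction n as [|n IH]; intros H.
  - exists 1; split; [lra|lia].
  - destruct IH as [d1 [d1pos H1]]; [intros i Hi; apply H; lia|].
    destruct (H n) as [d2 [d2pos H2]]; [lia|].
    assert (0 < Rmin d1 d2) by (apply Rmin_glb_lt; lra).
    pose proof (Rmin_l d1 d2); pose proof (Rmin_r d1 d2).
    exists (Rmin d1 d2); split; [assumption|]; intros i Hi.
    destruct (Nat.eq_dec i n) as [->|Hn]; [apply (mono _ d2)|apply (mono _ d1)];
      try lra; [assumption|apply H1; lia].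
Qed.

(** Local statements are proved one edge at a time; a link has finitely many edges, so the smallest
    radius serves for all of them. *)
Lemma finite_min_edges (L : list (list pt)) (P : nat -> nat -> R -> Prop) :
  (forall c i d d', 0 < d' <= d -> P c i d -> P c i d') ->
  (forall c i, valid L c i -> exists d, 0 < d /\ P c i d) ->
  exists d, 0 < d /\ forall c i, valid L c i -> P c i d.
Proof.
  intros mono H.
  destruct (finite_min (fun c d => forall i, (i < clen L c)%nat -> P c i d) (length L))
    as [d [dpos Hd]].
  - intros c d d' Hdd HP i Hi; apply (mono c i d); auto.
  - intros c Hc; apply finite_min; [intros i d d'; apply mono|].
    intros i Hi; apply H; split; assumption.
  - exists d; split; [assumption|]; intros c i [Hc Hi]; auto.
Qed.

(** Connectedness of the interval by a supremum argument. The local hypothesis compares good points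
    on both sides of [r] even when [r] is bad, so the value passes over isolated bad points. *)
Lemma locally_constant_off_discrete (T : Type) (f : R -> T) (bad : R -> Prop) :
  ~ bad 0 ->
  (forall r, 0 <= r <= 1 -> exists d, 0 < d /\
     (forall s, 0 <= s <= 1 -> s <> r -> Rabs (s - r) < d -> ~ bad s) /\
     (forall s t, 0 <= s <= 1 -> 0 <= t <= 1 -> Rabs (s - r) < d -> Rabs (t - r) < d ->
        ~ bad s -> ~ bad t -> f s = f t)) ->
  forall s, 0 <= s <= 1 -> ~ bad s -> f s = f 0.
Proof.
  intros bad0 loc.
  pose (E t := 0 <= t <= 1 /\ forall s, 0 <= s <= t -> ~ bad s -> f s = f 0).
  assert (E0 : E 0).
  { split; [lra|]; intros s Hs _; replace s with 0 by lra; reflexivity. }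
  destruct (completeness E) as [m [ub lub]].
  { exists 1; intros t [Ht _]; lra. }
  { exists 0; exact E0. }
  assert (Hm : 0 <= m <= 1).
  { split; [apply ub, E0|apply lub; intros t [Ht _]; lra]. }
  destruct (loc m Hm) as [d [dpos [isol const]]].
  assert (exists t, E t /\ m - d < t) as [t [[Ht Et] Hmt]].
  { apply NNPP; intros N.
    assert (m <= m - d); [|lra].
    apply lub; intros t Et; apply Rnot_lt_le; intros Hlt; apply N; eauto. }
  assert (Htm : t <= m) by (apply ub; split; assumption).
  (* A good point close to [m] at which the value is already known: [0] itself if [t = 0], otherwise
     a midpoint strictly below [t], hence different from [m] and good by isolation. *)
  assert (exists r, 0 <= r <= t /\ m - d < r /\ ~ bad r) as [r [Hr [Hr' badr]]].
  { destruct (Req_dec t 0) as [->|t0]; [exists 0; repeat split; auto; lra|].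
    pose (r := (Rmax 0 (m - d) + t) / 2).
    assert (Rmax 0 (m - d) < t) by (apply Rmax_lub_lt; lra).
    pose proof (Rmax_l 0 (m - d)); pose proof (Rmax_r 0 (m - d)).
    exists r; unfold r; repeat split; try lra.
    apply isol; try lra; apply Rabs_def1; lra. }
  assert (near_m : forall s, 0 <= s <= 1 -> s < m + d -> ~ bad s -> f s = f 0).
  { intros s Hs Hsd bads.
    destruct (Rle_lt_dec s r) as [Hle|Hlt]; [apply Et; [lra|assumption]|].
    rewrite <- (Et r) by (lra || assumption).
    apply const; try lra; try assumption; apply Rabs_def1; lra. }
  (* Otherwise the agreement would extend to [m + d / 2], capped at [1], beyond the supremum. *)
  assert (m1 : m = 1).
  { apply NNPP; intros m1.
    assert (E (Rmin 1 (m + d / 2))) as Em.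
    { pose proof (Rmin_l 1 (m + d / 2)); pose proof (Rmin_r 1 (m + d / 2)).
      assert (0 < Rmin 1 (m + d / 2)) by (apply Rmin_glb_lt; lra).
      split; [lra|]; intros s Hs; apply near_m; lra. }
    apply ub in Em.
    assert (m < Rmin 1 (m + d / 2)) by (apply Rmin_glb_lt; lra).
    lra. }
  intros s Hs; apply near_m; lra.
Qed.

(** * Ray parity of closed polygons in the plane *)

Fixpoint xsum (n : nat) (f : nat -> bool) : bool :=
  match n with O => false | S m => xorb (xsum m f) (f m) end.

Lemma xsum_ext n f g : (forall i, (i < n)%nat -> f i = g i) -> xsum n f = xsum n g.
Proof.
  induction n as [|n IH]; simpl; intros H; [reflexivity|].
  rewrite IH by (intros; apply H; lia); rewrite H by lia; reflexivity.
Qed.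

Lemma xsum_xorb n f g : xsum n (fun i => xorb (f i) (g i)) = xorb (xsum n f) (xsum n g).
Proof.
  induction n as [|n IH]; simpl; [reflexivity|]; rewrite IH.
  destruct (xsum n f), (xsum n g), (f n), (g n); reflexivity.
Qed.

Lemma xsum_neq n k f g : (k < n)%nat ->
  (forall i, (i < n)%nat -> i <> k -> f i = g i) -> f k <> g k -> xsum n f <> xsum n g.
Proof.
  induction n as [|n IH]; simpl; intros Hk H Hfg; [lia|].
  destruct (Nat.eq_dec k n) as [->|Hkn].
  - rewrite (xsum_ext n f g) by (intros; apply H; lia).
    destruct (xsum n g), (f n), (g n); simpl; congruence.
  - rewrite (H n) by lia.
    assert (xsum n f <> xsum n g) by (apply IH; [lia|intros; apply H; lia|assumption]).
    destruct (xsum n f), (xsum n g), (g n); simpl; congruence.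
Qed.

Lemma xsum_shift n f : xsum n (fun i => f (S i)) = xorb (f 0%nat) (xsum (S n) f).
Proof.
  induction n as [|n IH]; [simpl; destruct (f 0%nat); reflexivity|].
  change (xsum (S n) (fun i => f (S i))) with (xorb (xsum n (fun i => f (S i))) (f (S n))).
  rewrite IH; change (xsum (S (S n)) f) with (xorb (xsum (S n) f) (f (S n))).
  apply xorb_assoc.
Qed.

(** Telescoping modulo 2: around the cycle every value of [f] occurs twice, once for its own index
    and once as a successor. *)
Lemma xsum_cycle n f : xsum n (fun i => xorb (f i) (f (Nat.modulo (S i) n))) = false.
Proof.
  destruct n as [|n]; [reflexivity|].
  rewrite xsum_xorb.
  enough (xsum (S n) (fun i => f (Nat.modulo (S i) (S n))) = xsum (S n) f) as ->
    by apply xorb_nilpotent.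
  change (xorb (xsum n (fun i => f (Nat.modulo (S i) (S n)))) (f (Nat.modulo (S n) (S n)))
          = xsum (S n) f).
  rewrite Nat.Div0.mod_same.
  rewrite (xsum_ext n _ (fun i => f (S i))) by (intros; rewrite Nat.mod_small by lia; reflexivity).
  rewrite xsum_shift; destruct (f 0%nat), (xsum (S n) f); reflexivity.
Qed.

(** Twice the signed area of the triangle [a], [b], [p]; positive when [p] lies to the left of the
    line directed from [a] to [b]. *)
Definition cross (a b p : R * R) : R :=
  (fst b - fst a) * (snd p - snd a) - (snd b - snd a) * (fst p - fst a).

Definition below (a p : R * R) : bool := if Rle_dec (snd a) (snd p) then true else false.

Definition pos (x : R) : bool := if Rlt_dec 0 x then true else false.

(* Does the horizontal ray from [p] to the right meet the segment [ab]?  The lower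
   endpoint counts and the upper one does not; horizontal segments are never hit. *)
Definition ray_hit (a b p : R * R) : bool :=
  if below a p then (if below b p then false else pos (cross a b p))
  else (if below b p then pos (- cross a b p) else false).

(* The change of [ray_hit] caused by the vertex [v] when [q] moves to [p]. *)
Definition jump (q v p : R * R) : bool :=
  if Rlt_dec (fst q) (fst v) then xorb (below v q) (below v p) else false.

Definition mix (s : R) (a b : R * R) : R * R :=
  ((1 - s) * fst a + s * fst b, (1 - s) * snd a + s * snd b).

Definition on_seg2 (a b q : R * R) : Prop := exists s, 0 <= s <= 1 /\ q = mix s a b.

Definition close (q p : R * R) (d : R) : Prop :=
  Rabs (fst p - fst q) < d /\ Rabs (snd p - snd q) < d.

Lemma close_le q p d d' : d' <= d -> close q p d' -> close q p d.
Proof. unfold close; intros; lra. Qed.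

Lemma cross_sym a b p : cross b a p = - cross a b p.
Proof. unfold cross; ring. Qed.

Lemma ray_hit_sym a b p : ray_hit b a p = ray_hit a b p.
Proof.
  unfold ray_hit; rewrite cross_sym, Ropp_involutive.
  destruct (below a p), (below b p); reflexivity.
Qed.

Lemma on_seg2_sym a b q : on_seg2 b a q -> on_seg2 a b q.
Proof.
  intros [s [Hs ->]]; exists (1 - s); split; [lra|]; unfold mix; f_equal; ring.
Qed.

Lemma below_true a p : snd a <= snd p -> below a p = true.
Proof. unfold below; destruct Rle_dec; tauto. Qed.

Lemma below_false a p : snd p < snd a -> below a p = false.
Proof. unfold below; destruct Rle_dec; [lra|reflexivity]. Qed.

Lemma pos_true x : 0 < x -> pos x = true.
Proof. unfold pos; destruct Rlt_dec; tauto. Qed.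

Lemma pos_false x : x <= 0 -> pos x = false.
Proof. unfold pos; destruct Rlt_dec; [lra|reflexivity]. Qed.

Lemma below_locally_constant v q : snd v <> snd q ->
  exists d, 0 < d /\ forall p, close q p d -> below v p = below v q.
Proof.
  intros H; exists (Rabs (snd q - snd v)); split; [apply Rabs_pos_lt; lra|].
  intros p [_ Hp]; unfold below; revert Hp; unfold Rabs.
  destruct (Rcase_abs (snd q - snd v)), (Rcase_abs (snd p - snd q)), (Rle_dec (snd v) (snd p)),
    (Rle_dec (snd v) (snd q)); intros; (reflexivity || lra).
Qed.

Lemma cross_locally_constant a b q : cross a b q <> 0 ->
  exists d, 0 < d /\ forall p, close q p d ->
    pos (cross a b p) = pos (cross a b q) /\ pos (- cross a b p) = pos (- cross a b q).
Proof.
  intros H.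
  (* [cross a b] is affine in [p], and [M] exceeds its Lipschitz constant for the sup distance; the
     added [1] also keeps [M] nonzero. *)
  pose (M := Rabs (fst b - fst a) + Rabs (snd b - snd a) + 1).
  assert (HM : 0 < M)
    by (unfold M; pose proof (Rabs_pos (fst b - fst a)); pose proof (Rabs_pos (snd b - snd a)); lra).
  pose proof (Rabs_pos_lt _ H) as Hc.
  exists (Rabs (cross a b q) / M); split; [apply Rdiv_lt_0_compat; assumption|].
  intros p [H1 H2].
  assert (Rabs (cross a b p - cross a b q) < Rabs (cross a b q)) as Hlt.
  { replace (cross a b p - cross a b q)
      with ((fst b - fst a) * (snd p - snd q) - (snd b - snd a) * (fst p - fst q))
      by (unfold cross; ring).
    set (e := Rabs (cross a b q) / M) in *.
    assert (He : Rabs (cross a b q) = M * e) by (unfold e; field; lra).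
    assert (0 < e) by (unfold e; apply Rdiv_lt_0_compat; assumption).
    rewrite He; unfold M.
    eapply Rle_lt_trans; [apply Rabs_triang|].
    rewrite Rabs_Ropp, !Rabs_mult.
    pose proof (Rabs_pos (fst b - fst a)); pose proof (Rabs_pos (snd b - snd a)).
    nra. }
  revert Hlt; unfold Rabs, pos.
  destruct (Rcase_abs (cross a b q)), (Rcase_abs (cross a b p - cross a b q)); intros;
    repeat destruct Rlt_dec; split; (reflexivity || lra).
Qed.

Lemma jump_far q v p : below v p = below v q -> jump q v p = false.
Proof. unfold jump; intros ->; destruct Rlt_dec; [apply xorb_nilpotent|reflexivity]. Qed.

(** The endpoint [a] is level with [q] but differs from it, so [cross a b q] is nonzero and keeps
    its sign nearby. Only the comparison of [a] with [p] can change, and it affects the ray exactly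
    when [a] lies to the right of [q]. *)
Lemma ray_hit_near_endpoint a b q : snd a = snd q -> snd b <> snd q -> ~ on_seg2 a b q ->
  exists d, 0 < d /\ forall p, close q p d ->
    ray_hit a b p = xorb (ray_hit a b q) (xorb (jump q a p) (jump q b p)).
Proof.
  intros Ha Hb Hq.
  assert (Hx : fst a <> fst q).
  { intros E; apply Hq; exists 0; split; [lra|].
    unfold mix; rewrite (surjective_pairing q); f_equal; lra. }
  assert (Hc : cross a b q = (snd b - snd q) * (fst a - fst q))
    by (unfold cross; rewrite Ha; ring).
  destruct (below_locally_constant b q Hb) as [d1 [d1pos H1]].
  destruct (cross_locally_constant a b q) as [d2 [d2pos H2]].
  { rewrite Hc; apply Rmult_integral_contrapositive; split; lra. }
  exists (Rmin d1 d2); split; [apply Rmin_glb_lt; assumption|]; intros p Hp.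
  specialize (H1 p (close_le _ _ _ _ (Rmin_l _ _) Hp)).
  specialize (H2 p (close_le _ _ _ _ (Rmin_r _ _) Hp)).
  rewrite (jump_far q b p H1), xorb_false_r.
  unfold ray_hit, jump; rewrite H1, (proj1 H2), (proj2 H2), (below_true a q) by lra; rewrite Hc.
  destruct (Rlt_dec (fst q) (fst a)), (Rlt_dec (snd q) (snd b)).
  - rewrite (below_false b q), pos_true by nra; destruct (below a p); reflexivity.
  - rewrite (below_true b q) by lra; rewrite (pos_true (- _)) by nra.
    destruct (below a p); reflexivity.
  - rewrite (below_false b q), pos_false by nra; destruct (below a p); reflexivity.
  - rewrite (below_true b q) by lra; rewrite (pos_false (- _)) by nra.
    destruct (below a p); reflexivity.
Qed.

Lemma ray_hit_near a b q : ~ on_seg2 a b q ->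
  exists d, 0 < d /\ forall p, close q p d ->
    ray_hit a b p = xorb (ray_hit a b q) (xorb (jump q a p) (jump q b p)).
Proof.
  intros Hq.
  destruct (Req_dec (snd a) (snd q)) as [Ha|Ha], (Req_dec (snd b) (snd q)) as [Hb|Hb].
  (* A horizontal segment level with [q] is never hit. Both its ends lie on the same side of [q],
     otherwise [q] would be on it, so the two jumps cancel. *)
  - exists 1; split; [lra|]; intros p _.
    assert (Eab : forall r, below a r = below b r) by (intros r; unfold below; rewrite Ha, Hb; reflexivity).
    assert (Hh : forall r, ray_hit a b r = false)
      by (intros r; unfold ray_hit; rewrite Eab; destruct (below b r); reflexivity).
    rewrite !Hh; unfold jump; rewrite !Eab.
    destruct (Rlt_dec (fst q) (fst a)), (Rlt_dec (fst q) (fst b));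
      try (symmetry; rewrite xorb_false_l; apply xorb_nilpotent); try reflexivity;
      exfalso; apply Hq.
    + assert (Hne : fst a - fst b > 0) by lra.
      exists ((fst a - fst q) / (fst a - fst b)); split.
      * split; [apply Rle_mult_inv_pos; lra|].
        apply (Rmult_le_reg_r (fst a - fst b)); [lra|].
        unfold Rdiv; rewrite Rmult_assoc, Rinv_l by lra; lra.
      * unfold mix; rewrite (surjective_pairing q), Ha, Hb; simpl; f_equal; field; lra.
    + assert (Hne : fst b - fst a > 0) by lra.
      exists ((fst q - fst a) / (fst b - fst a)); split.
      * split; [apply Rle_mult_inv_pos; lra|].
        apply (Rmult_le_reg_r (fst b - fst a)); [lra|].
        unfold Rdiv; rewrite Rmult_assoc, Rinv_l by lra; lra.
      * unfold mix; rewrite (surjective_pairing q), Ha, Hb; simpl; f_equal; field; lra.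
  - apply ray_hit_near_endpoint; assumption.
  - destruct (ray_hit_near_endpoint b a q) as [d [dpos H]]; try assumption.
    { intros N; apply Hq, on_seg2_sym, N. }
    exists d; split; [assumption|]; intros p Hp.
    rewrite <- (ray_hit_sym a b p), <- (ray_hit_sym a b q), (H p Hp), (xorb_comm (jump q a p)).
    reflexivity.
  - destruct (below_locally_constant a q Ha) as [d1 [d1pos H1]].
    destruct (below_locally_constant b q Hb) as [d2 [d2pos H2]].
    destruct (classic (cross a b q = 0)) as [Hc|Hc].
    (* Here [q] is on the line of the segment but off the segment, hence above both ends or below
       both; otherwise its relative height would be a parameter placing it on the segment. *)
    + assert (Hs : below a q = below b q).
      { unfold below; destruct (Rle_dec (snd a) (snd q)), (Rle_dec (snd b) (snd q));
          try reflexivity; exfalso; apply Hq;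
          exists ((snd q - snd a) / (snd b - snd a)); split.
        - split; [apply Rle_mult_inv_pos; lra|].
          apply (Rmult_le_reg_r (snd b - snd a)); [lra|].
          unfold Rdiv; rewrite Rmult_assoc, Rinv_l by lra; lra.
        - unfold mix; rewrite (surjective_pairing q); simpl; f_equal; [|field; lra].
          unfold cross in Hc; apply (Rmult_eq_reg_l (snd b - snd a)); [|lra].
          field_simplify; lra.
        - replace ((snd q - snd a) / (snd b - snd a)) with ((snd a - snd q) / (snd a - snd b))
            by (field; lra).
          split; [apply Rle_mult_inv_pos; lra|].
          apply (Rmult_le_reg_r (snd a - snd b)); [lra|].
          unfold Rdiv; rewrite Rmult_assoc, Rinv_l by lra; lra.
        - unfold mix; rewrite (surjective_pairing q); simpl; f_equal; [|field; lra].
          unfold cross in Hc; apply (Rmult_eq_reg_l (snd b - snd a)); [|lra].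
          field_simplify; lra. }
      exists (Rmin d1 d2); split; [apply Rmin_glb_lt; assumption|]; intros p Hp.
      specialize (H1 p (close_le _ _ _ _ (Rmin_l _ _) Hp)).
      specialize (H2 p (close_le _ _ _ _ (Rmin_r _ _) Hp)).
      rewrite !jump_far by assumption.
      unfold ray_hit; rewrite H1, H2, Hs; destruct (below b q); reflexivity.
    + destruct (cross_locally_constant a b q Hc) as [d3 [d3pos H3]].
      exists (Rmin d1 (Rmin d2 d3)); split; [repeat apply Rmin_glb_lt; assumption|]; intros p Hp.
      specialize (H1 p (close_le _ _ _ _ (Rmin_l _ _) Hp)).
      apply (close_le _ _ _ _ (Rmin_r _ _)) in Hp.
      specialize (H2 p (close_le _ _ _ _ (Rmin_l _ _) Hp)).
      specialize (H3 p (close_le _ _ _ _ (Rmin_r _ _) Hp)).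
      rewrite !jump_far by assumption.
      unfold ray_hit; rewrite H1, H2, (proj1 H3), (proj2 H3); rewrite !xorb_false_r; reflexivity.
Qed.

(** The ray test with the endpoint jumps undone, so that it is constant in [p] around a point [q]
    off the segment. *)
Definition corrected_hit (a b q p : R * R) : bool :=
  xorb (ray_hit a b p) (xorb (jump q a p) (jump q b p)).

Lemma corrected_hit_off a b q : ~ on_seg2 a b q ->
  exists d, 0 < d /\ forall p, close q p d -> corrected_hit a b q p = ray_hit a b q.
Proof.
  intros Hq; destruct (ray_hit_near a b q Hq) as [d [dpos H]].
  exists d; split; [assumption|]; intros p Hp; unfold corrected_hit; rewrite (H p Hp).
  destruct (ray_hit a b q), (jump q a p), (jump q b p); reflexivity.
Qed.

(** If the segment is not horizontal, both jumps vanish near [q] and the ray test reads off the sign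
    of [cross]. If it is horizontal, the ray test is silent, but exactly one end lies to the right
    of [q], and its jump tells whether the point is above or below the segment. *)
Lemma corrected_hit_flips a b s : 0 < s < 1 -> a <> b ->
  exists d, 0 < d /\ forall x y, close (mix s a b) x d -> close (mix s a b) y d ->
    cross a b x * cross a b y < 0 ->
    corrected_hit a b (mix s a b) x <> corrected_hit a b (mix s a b) y.
Proof.
  intros Hs Hab; set (q := mix s a b).
  assert (Hq : fst q = (1 - s) * fst a + s * fst b /\ snd q = (1 - s) * snd a + s * snd b)
    by (split; reflexivity).
  destruct Hq as [Hq1 Hq2].
  destruct (Req_dec (snd a) (snd b)) as [E|E].
  - exists 1; split; [lra|]; intros x y _ _.
    assert (Eab : forall r, below a r = below b r) by (intros r; unfold below; rewrite E; reflexivity).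
    assert (Hh : forall r, ray_hit a b r = false)
      by (intros r; unfold ray_hit; rewrite Eab; destruct (below b r); reflexivity).
    unfold corrected_hit; rewrite !Hh; unfold jump; rewrite !Eab.
    unfold cross; rewrite E; intros Hxy.
    assert (Hne : fst a <> fst b).
    { intros N; apply Hab; rewrite (surjective_pairing a), (surjective_pairing b); f_equal; lra. }
    assert (Hp : (snd x - snd b) * (snd y - snd b) < 0).
    { apply Rnot_le_lt; intros N.
      pose proof (Rmult_le_pos _ _ (pow2_ge_0 (fst b - fst a)) N); nra. }
    assert (Hxy' : below b x <> below b y).
    { unfold below; destruct (Rle_dec (snd b) (snd x)), (Rle_dec (snd b) (snd y));
        try discriminate; exfalso; nra. }
    destruct (Rlt_dec (fst q) (fst a)), (Rlt_dec (fst q) (fst b)); try (exfalso; nra);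
      destruct (below b x), (below b y), (below b q); simpl; congruence.
  - assert (snd a <> snd q).
    { rewrite Hq2; intros N; apply E, (Rmult_eq_reg_l s); lra. }
    assert (snd b <> snd q).
    { rewrite Hq2; intros N; apply E, (Rmult_eq_reg_l (1 - s)); lra. }
    destruct (below_locally_constant a q) as [d1 [d1pos H1]]; [assumption|].
    destruct (below_locally_constant b q) as [d2 [d2pos H2]]; [assumption|].
    exists (Rmin d1 d2); split; [apply Rmin_glb_lt; assumption|]; intros x y Hx Hy Hxy.
    pose proof (H1 x (close_le _ _ _ _ (Rmin_l _ _) Hx)) as H1x.
    pose proof (H2 x (close_le _ _ _ _ (Rmin_r _ _) Hx)) as H2x.
    pose proof (H1 y (close_le _ _ _ _ (Rmin_l _ _) Hy)) as H1y.
    pose proof (H2 y (close_le _ _ _ _ (Rmin_r _ _) Hy)) as H2y.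
    unfold corrected_hit; rewrite !jump_far by assumption.
    unfold ray_hit; rewrite H1x, H2x, H1y, H2y; unfold below, pos.
    destruct (Rle_dec (snd a) (snd q)), (Rle_dec (snd b) (snd q)); try (exfalso; nra);
      repeat destruct Rlt_dec; simpl; try discriminate; exfalso; nra.
Qed.

(** * Parity of a planar point with respect to selected components *)

Definition vtx2 (L : list (list pt)) (c i : nat) : R * R := proj (vtx L c i).

(** For [p] off the projected components selected by [K], this is their total winding number around
    [p] modulo 2. *)
Definition ray_parity (L : list (list pt)) (K : nat -> bool) (p : R * R) : bool :=
  xsum (length L) (fun c => if K c then
    xsum (clen L c) (fun i => ray_hit (vtx2 L c i) (vtx2 L c (nxt L c i)) p) else false).

(* The jumps at the vertices cancel around each closed polygon. *)
Lemma ray_parity_corrected L K q p :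
  ray_parity L K p =
  xsum (length L) (fun c => if K c then
    xsum (clen L c) (fun i => corrected_hit (vtx2 L c i) (vtx2 L c (nxt L c i)) q p) else false).
Proof.
  unfold ray_parity; apply xsum_ext; intros c _; destruct (K c); [|reflexivity].
  unfold corrected_hit; rewrite xsum_xorb.
  unfold nxt at 3; rewrite (xsum_cycle (clen L c) (fun i => jump q (vtx2 L c i) p)).
  rewrite xorb_false_r; reflexivity.
Qed.

Definition on_edge2 (L : list (list pt)) (c i : nat) (q : R * R) : Prop :=
  on_seg2 (vtx2 L c i) (vtx2 L c (nxt L c i)) q.

(** [S] is the set of all selected edges when the parity is shown to be locally constant, and omits
    the crossed edge when it is shown to flip. *)
Lemma corrected_hit_off_edges L (S : nat -> nat -> Prop) q :
  (forall c i, valid L c i -> S c i -> ~ on_edge2 L c i q) ->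
  exists d, 0 < d /\ forall c i, valid L c i -> S c i -> forall p, close q p d ->
    corrected_hit (vtx2 L c i) (vtx2 L c (nxt L c i)) q p
    = ray_hit (vtx2 L c i) (vtx2 L c (nxt L c i)) q.
Proof.
  intros H.
  apply (finite_min_edges L (fun c i d => S c i -> forall p, close q p d ->
    corrected_hit (vtx2 L c i) (vtx2 L c (nxt L c i)) q p
    = ray_hit (vtx2 L c i) (vtx2 L c (nxt L c i)) q)).
  - intros c i d d' Hd HP HS p Hp; apply HP; [assumption|].
    apply (close_le _ _ _ d'); [lra|assumption].
  - intros c i Hv; destruct (classic (S c i)) as [HS|HS]; [|exists 1; split; [lra|tauto]].
    destruct (corrected_hit_off (vtx2 L c i) (vtx2 L c (nxt L c i)) q) as [d [dpos Hd]].
    { apply H; assumption. }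
    exists d; split; [assumption|]; intros _; exact Hd.
Qed.

Lemma ray_parity_locally_constant L K q :
  (forall c i, valid L c i -> K c = true -> ~ on_edge2 L c i q) ->
  exists d, 0 < d /\ forall p, close q p d -> ray_parity L K p = ray_parity L K q.
Proof.
  intros H.
  destruct (corrected_hit_off_edges L (fun c _ => K c = true) q H) as [d [dpos Hd]].
  exists d; split; [assumption|]; intros p Hp.
  rewrite (ray_parity_corrected L K q p); unfold ray_parity.
  apply xsum_ext; intros c Hc; destruct (K c) eqn:HK; [|reflexivity].
  apply xsum_ext; intros i Hi; apply Hd; [split|..]; assumption.
Qed.

(** After correction at [q], every selected edge except the one through [q] contributes the same to
    both points, and that one contributes differently. *)
Lemma ray_parity_flips L K c i s :
  valid L c i -> K c = true -> 0 < s < 1 ->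
  vtx2 L c i <> vtx2 L c (nxt L c i) ->
  let q := mix s (vtx2 L c i) (vtx2 L c (nxt L c i)) in
  (forall d j, valid L d j -> K d = true -> on_edge2 L d j q -> d = c /\ j = i) ->
  exists d, 0 < d /\ forall x y, close q x d -> close q y d ->
    cross (vtx2 L c i) (vtx2 L c (nxt L c i)) x * cross (vtx2 L c i) (vtx2 L c (nxt L c i)) y < 0 ->
    ray_parity L K x <> ray_parity L K y.
Proof.
  intros Hv HK Hs Hne q Huniq.
  destruct (corrected_hit_flips (vtx2 L c i) (vtx2 L c (nxt L c i)) s Hs Hne) as [d1 [d1pos H1]].
  destruct (corrected_hit_off_edges L (fun d j => K d = true /\ ~ (d = c /\ j = i)) q)
    as [d2 [d2pos H2]].
  { intros d j Hdj [HKd Hn] Hon; apply Hn, Huniq; assumption. }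
  exists (Rmin d1 d2); split; [apply Rmin_glb_lt; assumption|]; intros x y Hx Hy Hxy.
  rewrite (ray_parity_corrected L K q x), (ray_parity_corrected L K q y).
  pose proof (close_le _ _ _ _ (Rmin_r _ _) Hx) as Hx2.
  pose proof (close_le _ _ _ _ (Rmin_r _ _) Hy) as Hy2.
  destruct Hv as [Hc Hi].
  apply (xsum_neq _ c); [assumption| |].
  - intros d Hd Hdc; destruct (K d) eqn:HKd; [|reflexivity].
    apply xsum_ext; intros j Hj.
    rewrite !(H2 d j); try assumption; try reflexivity;
      split; assumption || (intros [? ?]; auto).
  - rewrite HK; apply (xsum_neq _ i); [assumption| |].
    + intros j Hj Hji.
      rewrite !(H2 c j); try assumption; try reflexivity;
        split; assumption || (intros [? ?]; auto).
    + apply H1; [| |assumption];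
        (apply (close_le _ _ _ (Rmin d1 d2)); [apply Rmin_l|assumption]).
Qed.

(** * Crossings of a regular diagram *)

Definition edge_pt (L : list (list pt)) (c i : nat) (s : R) : pt :=
  comb s (vtx L c i) (vtx L c (nxt L c i)).

Lemma edge_pt_on_edge L c i s : 0 <= s <= 1 -> on_edge L c i (edge_pt L c i s).
Proof. intros Hs; exists s; split; [assumption|reflexivity]. Qed.

Lemma edge_pt_points L c i s : valid L c i -> 0 <= s <= 1 -> points L (edge_pt L c i s).
Proof. intros Hv Hs; exists c, i; split; [assumption|apply edge_pt_on_edge, Hs]. Qed.

Lemma edge_pt_0 L c i : edge_pt L c i 0 = vtx L c i.
Proof.
  unfold edge_pt, comb; destruct (vtx L c i) as [[x y] z]; unfold px, py, pz; simpl.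
  repeat f_equal; ring.
Qed.

Lemma edge_pt_1 L c i : edge_pt L c i 1 = vtx L c (nxt L c i).
Proof.
  unfold edge_pt, comb; destruct (vtx L c (nxt L c i)) as [[x y] z]; unfold px, py, pz; simpl.
  repeat f_equal; ring.
Qed.

Lemma proj_edge_pt L c i s :
  proj (edge_pt L c i s) = mix s (vtx2 L c i) (vtx2 L c (nxt L c i)).
Proof. reflexivity. Qed.

Lemma valid_nxt L c i : valid L c i -> valid L c (nxt L c i).
Proof. intros [Hc Hi]; split; [assumption|apply Nat.mod_upper_bound; lia]. Qed.

Lemma vtx_points L c i : valid L c i -> points L (vtx L c i).
Proof. intros Hv; rewrite <- edge_pt_0; apply edge_pt_points; [assumption|lra]. Qed.

(** * Distances between points and segments in space *)

Lemma pt_eq (p q : pt) : proj p = proj q -> pz p = pz q -> p = q.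
Proof.
  destruct p as [[x y] z], q as [[x' y'] z']; unfold proj, px, py, pz; simpl; intros H ->.
  injection H as -> ->; reflexivity.
Qed.

Lemma dist2_comb a b s t : dist2 (comb s a b) (comb t a b) = (s - t) ^ 2 * dist2 a b.
Proof. unfold dist2, comb, px, py, pz; simpl; ring. Qed.

Lemma dist2_pos p q : p <> q -> 0 < dist2 p q.
Proof.
  intros H; apply Rnot_le_lt; intros N; apply H; unfold dist2 in N.
  pose proof (pow2_ge_0 (px p - px q)); pose proof (pow2_ge_0 (py p - py q));
    pose proof (pow2_ge_0 (pz p - pz q)).
  apply pt_eq; [unfold proj; f_equal|]; nra.
Qed.

Lemma near_le p q e e' : 0 < e' <= e -> near p q e' -> near p q e.
Proof. unfold near; intros; nra. Qed.

Lemma near_close p q e : 0 < e -> near p q e -> close (proj p) (proj q) e.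
Proof.
  unfold near, dist2, close, proj; simpl; intros He H.
  pose proof (pow2_ge_0 (px p - px q)); pose proof (pow2_ge_0 (py p - py q));
    pose proof (pow2_ge_0 (pz p - pz q)).
  split; apply Rabs_def1; nra.
Qed.

Lemma comb_near a b s e : 0 < e ->
  exists d, 0 < d /\ forall t, Rabs (t - s) < d -> near (comb s a b) (comb t a b) e.
Proof.
  intros He.
  assert (HD : 0 <= dist2 a b)
    by (unfold dist2; pose proof (pow2_ge_0 (px a - px b)); pose proof (pow2_ge_0 (py a - py b));
        pose proof (pow2_ge_0 (pz a - pz b)); lra).
  set (D := dist2 a b) in *.
  (* With [D] the squared length and [d] this radius, the squared distance is below
     [d ^ 2 * (D + 1)], hence below [(d * (D + 1)) ^ 2 = e ^ 2]; no square root is needed. *)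
  exists (e / (D + 1)); split; [apply Rdiv_lt_0_compat; lra|].
  intros t Ht; unfold near; rewrite dist2_comb; fold D.
  set (d := e / (D + 1)) in *.
  assert (Hd : e = d * (D + 1)) by (unfold d; field; lra).
  assert (Hd0 : 0 < d) by (unfold d; apply Rdiv_lt_0_compat; lra).
  assert ((s - t) ^ 2 < d ^ 2) by (apply Rabs_def2 in Ht; nra).
  rewrite Hd.
  assert (d ^ 2 * (D + 1) <= (d * (D + 1)) ^ 2).
  { replace ((d * (D + 1)) ^ 2) with (d ^ 2 * (D + 1) * (D + 1)) by ring.
    pose proof (pow2_ge_0 d); assert (0 <= d ^ 2 * (D + 1)) by nra; nra. }
  pose proof (pow2_ge_0 d); nra.
Qed.

Lemma near_comb a b s d : a <> b -> 0 < d ->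
  exists e, 0 < e /\ forall t, near (comb s a b) (comb t a b) e -> Rabs (t - s) < d.
Proof.
  intros Hab Hd; pose proof (dist2_pos _ _ Hab) as HD.
  pose proof (sqrt_lt_R0 _ HD) as Hs.
  exists (d * sqrt (dist2 a b)); split; [apply Rmult_lt_0_compat; assumption|].
  intros t; unfold near; rewrite dist2_comb, Rpow_mult_distr, pow2_sqrt by lra; intros H.
  apply Rmult_lt_reg_r in H; [|assumption].
  apply Rabs_def1; nra.
Qed.

(** Compactness: the distance to [q] attains a minimum on the segment, and it is positive. *)
Lemma seg_far a b q : ~ on_seg a b q ->
  exists e, 0 < e /\ forall x, on_seg a b x -> ~ near q x e.
Proof.
  intros H.
  destruct (continuity_ab_min (fun s => dist2 q (comb s a b)) 0 1) as [m [Hmin Hm]]; [lra| |].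
  { intros s _; apply derivable_continuous_pt; unfold dist2, comb, px, py, pz; simpl; reg. }
  assert (Hpos : 0 < dist2 q (comb m a b)).
  { apply dist2_pos; intros E; apply H; exists m; auto. }
  exists (sqrt (dist2 q (comb m a b))); split; [apply sqrt_lt_R0; assumption|].
  intros x [s [Hs ->]]; unfold near; rewrite pow2_sqrt by lra.
  specialize (Hmin s Hs); simpl in Hmin; lra.
Qed.

Lemma odd_sum a b c : (2 * a = b + c)%Z -> Z.odd b = Z.odd c.
Proof.
  intros H; assert (Z.odd (b + c) = false) as E by (rewrite <- H, Z.odd_mul; reflexivity).
  rewrite Z.odd_add in E; destruct (Z.odd b), (Z.odd c); simpl in E; congruence.
Qed.

(** * Under-crossing points and their neighbourhoods *)

Section Diagram.

Variable L : list (list pt).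
Hypothesis link : pl_link L.
Hypothesis reg_diag : regular L.

(** A point both above [q] and below a third point would create a triple point of the projection. *)
Lemma over_not_under p q : points L p -> points L q -> proj p = proj q -> pz q < pz p ->
  ~ under L p.
Proof.
  intros Hp Hq E Hz [_ [r [Hr [Er Hrz]]]].
  destruct reg_diag as [triple _].
  destruct (triple q p r) as [ -> | [ -> | -> ]]; try assumption; try congruence; lra.
Qed.

Lemma vtx_not_under c i : valid L c i -> ~ under L (vtx L c i).
Proof.
  intros Hv [_ [p [Hp [E Hz]]]]; destruct reg_diag as [_ [vert _]].
  rewrite (vert c i p) in Hz by assumption; lra.
Qed.

Lemma under_edge_pt q : under L q ->
  exists c i s, valid L c i /\ 0 < s < 1 /\ q = edge_pt L c i s.
Proof.
  intros Hu; pose proof Hu as [[c [i [Hv [s [Hs E]]]]] _].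
  fold (edge_pt L c i s) in E.
  exists c, i, s; split; [assumption|]; split; [|assumption].
  destruct (Req_dec s 0) as [->|H0].
  { rewrite edge_pt_0 in E; subst q; exfalso; eapply vtx_not_under; eassumption. }
  destruct (Req_dec s 1) as [->|H1].
  { rewrite edge_pt_1 in E; subst q; exfalso; eapply vtx_not_under; [|eassumption].
    apply valid_nxt, Hv. }
  lra.
Qed.

Lemma vtx2_neq c i : valid L c i -> vtx2 L c i <> vtx2 L c (nxt L c i).
Proof.
  intros Hv E; destruct reg_diag as [_ [vert _]]; destruct link as [_ [_ [nondeg _]]].
  apply (nondeg c i Hv); symmetry; apply (vert c i); [assumption| |symmetry; exact E].
  apply vtx_points, valid_nxt, Hv.
Qed.

(** At a crossing the two projected edges have independent directions, so their lines meet only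
    once. *)
Lemma edges_cross_once c i d j s s' t t' :
  valid L c i -> valid L d j ->
  0 <= s <= 1 -> 0 <= s' <= 1 -> 0 <= t <= 1 -> 0 <= t' <= 1 ->
  proj (edge_pt L c i s) = proj (edge_pt L d j t) ->
  edge_pt L c i s <> edge_pt L d j t ->
  proj (edge_pt L c i s') = proj (edge_pt L d j t') ->
  s = s'.
Proof.
  intros Hv Hw Hs Hs' Ht Ht' E N E'.
  destruct reg_diag as [_ [_ trans]].
  specialize (trans c i d j _ _ Hv Hw (edge_pt_on_edge L c i s Hs) (edge_pt_on_edge L d j t Ht) N E).
  simpl in trans.
  unfold proj, edge_pt, comb in E, E'; unfold px, py in *; simpl in E, E'.
  injection E as E1 E2; injection E' as E3 E4.
  apply Rminus_diag_uniq.
  match type of trans with ?D <> 0 => apply (Rmult_eq_reg_r D); [|exact trans] end.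
  rewrite Rmult_0_l.
  set (ax := fst (fst (vtx L c i))) in *; set (ay := snd (fst (vtx L c i))) in *.
  set (bx := fst (fst (vtx L c (nxt L c i)))) in *; set (b_y := snd (fst (vtx L c (nxt L c i)))) in *.
  set (ax' := fst (fst (vtx L d j))) in *; set (ay' := snd (fst (vtx L d j))) in *.
  set (bx' := fst (fst (vtx L d (nxt L d j)))) in *;
    set (b_y' := snd (fst (vtx L d (nxt L d j)))) in *.
  assert (X : (s - s') * (bx - ax) = (t - t') * (bx' - ax')) by lra.
  assert (Y : (s - s') * (b_y - ay) = (t - t') * (b_y' - ay')) by lra.
  replace ((s - s') * ((bx - ax) * (b_y' - ay') - (b_y - ay) * (bx' - ax')))
    with ((s - s') * (bx - ax) * (b_y' - ay') - (s - s') * (b_y - ay) * (bx' - ax')) by ring.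
  rewrite X, Y; ring.
Qed.

(** Each edge passes over the given one at no more than one parameter, so finitely many parameters
    have to be avoided. *)
Lemma under_isolated_on_edge c i r : valid L c i ->
  exists d, 0 < d /\ forall s, 0 <= s <= 1 -> s <> r -> Rabs (s - r) < d ->
    ~ under L (edge_pt L c i s).
Proof.
  intros Hv.
  pose (U d j s := 0 <= s <= 1 /\ exists t, 0 <= t <= 1 /\
          proj (edge_pt L d j t) = proj (edge_pt L c i s) /\
          pz (edge_pt L c i s) < pz (edge_pt L d j t)).
  destruct (finite_min_edges L (fun d j e => forall s, U d j s -> s <> r -> Rabs (s - r) < e -> False))
    as [e [epos He]].
  - intros d j e e' He H s HU Hs Hlt; apply (H s HU Hs); lra.
  - intros d j Hw.
    destruct (classic (exists s, U d j s /\ s <> r)) as [[s [[Hs [t [Ht [E Hz]]]] Hsr]]|N].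
    + exists (Rabs (s - r)); split; [apply Rabs_pos_lt; lra|].
      intros s' [Hs' [t' [Ht' [E' Hz']]]] _ Hlt.
      assert (s = s') as ->; [|lra].
      apply (edges_cross_once c i d j s s' t t'); try assumption; try (symmetry; assumption).
      intros Q; rewrite Q in Hz; lra.
    + exists 1; split; [lra|]; intros s HU Hs _; apply N; eauto.
  - exists e; split; [assumption|]; intros s Hs Hsr Hlt [_ [p [[d [j [Hw [t [Ht Ep]]]]] [E Hz]]]].
    subst p; apply (He d j Hw s); [|assumption..].
    split; [assumption|]; exists t; auto.
Qed.

(** Neither strand of a crossing has a vertex there, and distinct edges of the link share only
    vertices. The disjunction covers the lower and the upper strand. *)
Lemma under_edge_unique c i d j s : valid L c i -> valid L d j -> 0 <= s <= 1 ->
  (under L (edge_pt L c i s) \/ exists q, under L q /\ proj q = proj (edge_pt L c i s)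
     /\ q <> edge_pt L c i s) ->
  on_edge L d j (edge_pt L c i s) -> d = c /\ j = i.
Proof.
  intros Hv Hw Hs Hu Hon; destruct link as [_ [_ [_ simple]]].
  assert (notv : forall k, valid L c k -> edge_pt L c i s <> vtx L c k).
  { intros k Hk E; rewrite E in Hu; destruct Hu as [Hu|[q [Hq [Eq N]]]].
    - exact (vtx_not_under c k Hk Hu).
    - destruct reg_diag as [_ [vert _]]; apply N, vert; [assumption|apply Hq|assumption]. }
  destruct (simple c i d j _ Hv Hw (edge_pt_on_edge L c i s Hs) Hon)
    as [[<- <-]|[[<- [-> E]]|[<- [-> E]]]]; [auto| |]; exfalso; eapply notv; try exact E.
  - apply valid_nxt, Hv.
  - apply valid_nxt, Hw.
Qed.

(** All other edges stay at positive distance from [q], so near [q] the link is a piece of one edge,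
    on which under points are isolated. *)
Lemma near_under q c i r : under L q -> valid L c i -> 0 <= r <= 1 -> q = edge_pt L c i r ->
  exists e, 0 < e /\ forall x, points L x -> near q x e ->
    exists s, 0 <= s <= 1 /\ x = edge_pt L c i s /\ (x <> q -> ~ under L x).
Proof.
  intros Hu Hv Hr Hq.
  destruct (finite_min_edges L (fun c' j e => forall x, ~ (c' = c /\ j = i) -> on_edge L c' j x ->
      ~ near q x e)) as [e1 [e1pos H1]].
  - intros c' j e e' He H x N Hon Hnear; apply (H x N Hon), (near_le _ _ _ e'); assumption.
  - intros c' j Hw.
    destruct (classic (c' = c /\ j = i)) as [Y|N]; [exists 1; split; [lra|tauto]|].
    destruct (seg_far (vtx L c' j) (vtx L c' (nxt L c' j)) q) as [e [epos He]].
    { intros Hon; apply N; subst q; apply (under_edge_unique c i c' j r); auto. }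
    exists e; split; [assumption|]; intros x _; apply He.
  - destruct (under_isolated_on_edge c i r Hv) as [d2 [d2pos H2]].
    destruct link as [_ [_ [nondeg _]]].
    destruct (near_comb (vtx L c i) (vtx L c (nxt L c i)) r d2) as [e2 [e2pos H3]].
    { apply nondeg, Hv. }
    { assumption. }
    exists (Rmin e1 e2); split; [apply Rmin_glb_lt; assumption|].
    intros x [c' [j [Hw Hon]]] Hx.
    assert (Hmin : 0 < Rmin e1 e2) by (apply Rmin_glb_lt; assumption).
    destruct (classic (c' = c /\ j = i)) as [[-> ->]|N].
    + destruct Hon as [s [Hs E]].
      assert (Hlt : Rabs (s - r) < d2).
      { apply H3; rewrite <- E; fold (edge_pt L c i r); rewrite <- Hq.
        apply (near_le _ _ _ (Rmin e1 e2)); [split; [assumption|apply Rmin_r]|assumption]. }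
      exists s; split; [assumption|]; split; [assumption|].
      intros Hxq; rewrite E; apply H2; [assumption| |lra].
      intros ->; apply Hxq; rewrite E, Hq; reflexivity.
    + exfalso; apply (H1 c' j Hw x N Hon).
      apply (near_le _ _ _ (Rmin e1 e2)); [split; [assumption|apply Rmin_l]|assumption].
Qed.

Lemma edge_component c i d j x :
  valid L c i -> valid L d j -> on_edge L c i x -> on_edge L d j x -> c = d.
Proof.
  intros Hv Hw Hx Hy; destruct link as [_ [_ [_ simple]]].
  destruct (simple c i d j x) as [[E _]|[[E _]|[E _]]]; assumption.
Qed.

Lemma edge_pt_inj c i s t : valid L c i -> edge_pt L c i s = edge_pt L c i t -> s = t.
Proof.
  intros Hv E; destruct link as [_ [_ [nondeg _]]].
  pose proof (dist2_pos _ _ (nondeg c i Hv)) as HD.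
  pose proof (dist2_comb (vtx L c i) (vtx L c (nxt L c i)) s t) as HC.
  fold (edge_pt L c i s) (edge_pt L c i t) in HC; rewrite E in HC.
  replace (dist2 (edge_pt L c i t) (edge_pt L c i t)) with 0 in HC by (unfold dist2; ring).
  assert ((s - t) ^ 2 = 0) by nra; nra.
Qed.

Lemma comb_edge_pt c i u s t :
  comb u (edge_pt L c i s) (edge_pt L c i t) = edge_pt L c i ((1 - u) * s + u * t).
Proof. unfold edge_pt, comb, px, py, pz; simpl; apply f_equal2; [apply f_equal2|]; ring. Qed.

(* The case [x = y = q] is not excluded by [in_open_seg]. *)
Lemma crossing_neighbours q c i r :
  under L q -> valid L c i -> 0 <= r <= 1 -> q = edge_pt L c i r ->
  exists e, 0 < e /\ forall x y, points L x -> points L y -> near q x e -> near q y e ->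
    in_open_seg x y q ->
    (x = q /\ y = q) \/
    (~ under L x /\ ~ under L y /\ exists s t, 0 <= s <= 1 /\ 0 <= t <= 1 /\
       x = edge_pt L c i s /\ y = edge_pt L c i t /\ (s - r) * (t - r) < 0).
Proof.
  intros Hu Hv Hr Hq.
  destruct (near_under q c i r Hu Hv Hr Hq) as [e [epos He]].
  exists e; split; [assumption|]; intros x y Hx Hy Nx Ny [u [Hu01 Eq]].
  destruct (He x Hx Nx) as [s [Hs [Ex Ux]]]; destruct (He y Hy Ny) as [t [Ht [Ey Uy]]].
  (* Since [r] is a proper convex combination of [s] and [t], these either both equal [r] or lie
     strictly on opposite sides of it. *)
  assert (Er : r = (1 - u) * s + u * t).
  { apply (edge_pt_inj c i); [assumption|].
    rewrite <- comb_edge_pt, <- Ex, <- Ey, <- Eq; symmetry; assumption. }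
  destruct (Req_dec s r) as [E|N].
  - left; assert (t = r) as E' by (apply (Rmult_eq_reg_l u); nra).
    subst s t; split; congruence.
  - right; assert (t <> r) by (intros ->; apply N, (Rmult_eq_reg_l (1 - u)); nra).
    split; [apply Ux; intros E; apply N; apply (edge_pt_inj c i); congruence|].
    split; [apply Uy; intros E; apply H; apply (edge_pt_inj c i); congruence|].
    exists s, t; repeat split; try assumption; try lra.
    assert (E1 : (1 - u) * (s - r) = - (u * (t - r))) by lra.
    destruct (Rtotal_order s r) as [|[|]]; [|contradiction|]; nra.
Qed.

(** The crossing relation of [Zcoloring] only speaks of neighbours of the under point; these are
    witnesses for it, symmetric about [r]. *)
Lemma crossing_neighbours_exist c i r e :
  valid L c i -> 0 < r < 1 -> 0 < e ->
  exists s t, 0 <= s <= 1 /\ 0 <= t <= 1 /\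
    near (edge_pt L c i r) (edge_pt L c i s) e /\ near (edge_pt L c i r) (edge_pt L c i t) e /\
    ~ under L (edge_pt L c i s) /\ ~ under L (edge_pt L c i t) /\
    in_open_seg (edge_pt L c i s) (edge_pt L c i t) (edge_pt L c i r).
Proof.
  intros Hv Hr He.
  destruct (comb_near (vtx L c i) (vtx L c (nxt L c i)) r e He) as [d1 [d1pos H1]].
  destruct (under_isolated_on_edge c i r Hv) as [d2 [d2pos H2]].
  pose (d := Rmin (Rmin d1 d2) (Rmin r (1 - r)) / 2).
  assert (0 < d /\ d < d1 /\ d < d2 /\ d < r /\ d < 1 - r) as [Hd [Hd1 [Hd2 [Hd3 Hd4]]]].
  { assert (0 < Rmin (Rmin d1 d2) (Rmin r (1 - r))) by (repeat apply Rmin_glb_lt; lra).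
    pose proof (Rmin_l (Rmin d1 d2) (Rmin r (1 - r))).
    pose proof (Rmin_r (Rmin d1 d2) (Rmin r (1 - r))).
    pose proof (Rmin_l d1 d2); pose proof (Rmin_r d1 d2).
    pose proof (Rmin_l r (1 - r)); pose proof (Rmin_r r (1 - r)).
    unfold d; repeat split; lra. }
  exists (r - d), (r + d).
  assert (forall t, t = r - d \/ t = r + d -> Rabs (t - r) < d1 /\ Rabs (t - r) < d2).
  { intros t Ht; split; apply Rabs_def1; lra. }
  repeat split; try lra.
  - apply H1, H; auto.
  - apply H1, H; auto.
  - apply H2; [lra|lra|apply H; auto].
  - apply H2; [lra|lra|apply H; auto].
  - exists (1 / 2); split; [lra|]; rewrite comb_edge_pt; f_equal; field.
Qed.

(** * Recoloring a diagram *)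

Section Coloring.

Variable g : pt -> Z.
Hypothesis col : Zcoloring L g.

Definition color (z : Z) : Prop := exists x, points L x /\ ~ under L x /\ g x = z.

(** The crossing relation also holds for the degenerate pair [x = y = q], which reads
    [2 * g p = 2 * g q]. *)
Lemma under_color q p : points L q -> points L p -> proj p = proj q -> pz q < pz p -> g q = g p.
Proof.
  intros Hq Hp E Hz; destruct col as [_ cr].
  destruct (cr q p Hq Hp E Hz) as [e [epos He]].
  assert (near q q e) by (unfold near, dist2; nra).
  enough (2 * g p = g q + g q)%Z by lia.
  apply He; try assumption; exists (1 / 2); split; [lra|].
  destruct q as [[x y] z]; unfold comb, px, py, pz; simpl; repeat f_equal; field.
Qed.

(** At a crossing the over point and two proper neighbours lie on arcs, so [f] only has to respect
    progressions among colors of arcs. The degenerate pair is settled by [under_color]. *)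
Lemma recoloring_valid (f : Z -> Z) :
  (forall u o v, color u -> color o -> color v -> (2 * o = u + v)%Z -> (2 * f o = f u + f v)%Z) ->
  Zcoloring L (fun x => f (g x)).
Proof.
  intros Hf; destruct col as [loc cr]; split.
  - intros x Hx Ux; destruct (loc x Hx Ux) as [e [epos He]].
    exists e; split; [assumption|]; intros y Hy Uy N; f_equal; auto.
  - intros q p Hq Hp E Hz.
    assert (Hu : under L q) by (split; [assumption|]; exists p; auto).
    destruct (under_edge_pt q Hu) as [c [i [r [Hv [Hr Er]]]]].
    destruct (crossing_neighbours q c i r) as [e1 [e1pos H1]]; try assumption; [lra|].
    destruct (cr q p Hq Hp E Hz) as [e2 [e2pos H2]].
    assert (Hmin : 0 < Rmin e1 e2) by (apply Rmin_glb_lt; assumption).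
    pose proof (Rmin_l e1 e2); pose proof (Rmin_r e1 e2).
    exists (Rmin e1 e2); split; [assumption|]; intros x y Hx Hy Nx Ny S.
    destruct (H1 x y) as [[-> ->]|[Ux [Uy _]]]; try assumption.
    1,2: apply (near_le _ _ _ (Rmin e1 e2)); [lra|assumption].
    + rewrite (under_color q p) by assumption; lia.
    + apply Hf.
      * exists x; auto.
      * exists p; split; [assumption|]; split; [|reflexivity].
        apply (over_not_under p q); assumption.
      * exists y; auto.
      * apply H2; try assumption; apply (near_le _ _ _ (Rmin e1 e2)); lra || assumption.
Qed.

(** At an under point the colors on the two sides add up to an even number, so the parity survives
    the crossing. *)
Lemma edge_parity c i s : valid L c i -> 0 <= s <= 1 -> ~ under L (edge_pt L c i s) ->
  Z.odd (g (edge_pt L c i s)) = Z.odd (g (vtx L c i)).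
Proof.
  intros Hv Hs Us; rewrite <- (edge_pt_0 L c i).
  apply (locally_constant_off_discrete bool (fun s => Z.odd (g (edge_pt L c i s)))
           (fun s => under L (edge_pt L c i s))); [|clear s Hs Us|assumption..].
  { rewrite edge_pt_0; apply vtx_not_under, Hv. }
  intros r Hr; destruct (under_isolated_on_edge c i r Hv) as [d1 [d1pos H1]].
  destruct col as [loc cr].
  destruct (classic (under L (edge_pt L c i r))) as [Hu|Hu].
  - destruct (under_edge_pt _ Hu) as [c' [j [r' [Hw [Hr' E]]]]].
    assert (c' = c /\ j = i) as [-> ->].
    { apply (under_edge_unique c i c' j r); auto.
      rewrite E; apply edge_pt_on_edge; lra. }
    apply edge_pt_inj in E; [subst r'|assumption].
    pose proof Hu as [Hq [p [Hp [E Hz]]]].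
    destruct (cr _ p Hq Hp E Hz) as [e [epos He]].
    destruct (comb_near (vtx L c i) (vtx L c (nxt L c i)) r e epos) as [d2 [d2pos H2]].
    pose (d := Rmin (Rmin d1 d2) (Rmin r (1 - r))).
    assert (0 < d /\ d <= d1 /\ d <= d2 /\ d <= r /\ d <= 1 - r) as [Hd [Hd1 [Hd2 [Hd3 Hd4]]]].
    { assert (0 < d) by (repeat apply Rmin_glb_lt; lra).
      pose proof (Rmin_l (Rmin d1 d2) (Rmin r (1 - r))).
      pose proof (Rmin_r (Rmin d1 d2) (Rmin r (1 - r))).
      pose proof (Rmin_l d1 d2); pose proof (Rmin_r d1 d2).
      pose proof (Rmin_l r (1 - r)); pose proof (Rmin_r r (1 - r)).
      unfold d in *; repeat split; lra. }
    assert (opp : forall s t, 0 <= s <= 1 -> 0 <= t <= 1 -> Rabs (s - r) < d -> Rabs (t - r) < d ->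
      s < r < t -> Z.odd (g (edge_pt L c i s)) = Z.odd (g (edge_pt L c i t))).
    { intros s t Hs Ht Ds Dt Hst; apply (odd_sum (g p)), He.
      - apply edge_pt_points; assumption.
      - apply edge_pt_points; assumption.
      - apply H2; lra.
      - apply H2; lra.
      - exists ((r - s) / (t - s)); split.
        + split; [apply Rdiv_lt_0_compat; lra|].
          apply (Rmult_lt_reg_r (t - s)); [lra|].
          unfold Rdiv; rewrite Rmult_assoc, Rinv_l by lra; lra.
        + rewrite comb_edge_pt; f_equal; field; lra. }
    exists d; split; [assumption|]; split; [intros s Hs N Ds; apply H1; lra|].
    intros s t Hs Ht Ds Dt Us Ut.
    assert (s <> r) by (intros ->; contradiction).
    assert (t <> r) by (intros ->; contradiction).
    assert (Hl : Rabs (r - d / 2 - r) < d) by (apply Rabs_def1; lra).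
    assert (Hh : Rabs (r + d / 2 - r) < d) by (apply Rabs_def1; lra).
    (* The crossing relation compares opposite sides only; points on the same side are compared
       through [r + d / 2] or [r - d / 2] across the crossing. *)
    destruct (Rlt_le_dec s r), (Rlt_le_dec t r).
    + rewrite (opp s (r + d / 2)), (opp t (r + d / 2)); try lra; reflexivity.
    + apply opp; lra.
    + symmetry; apply opp; lra.
    + rewrite <- (opp (r - d / 2) s), <- (opp (r - d / 2) t); try lra; reflexivity.
  - destruct (loc _ (edge_pt_points L c i r Hv Hr) Hu) as [e [epos He]].
    destruct (comb_near (vtx L c i) (vtx L c (nxt L c i)) r e epos) as [d2 [d2pos H2]].
    pose proof (Rmin_l d1 d2); pose proof (Rmin_r d1 d2).
    exists (Rmin d1 d2); split; [apply Rmin_glb_lt; assumption|]; split.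
    { intros s Hs N Ds; apply H1; lra. }
    intros s t Hs Ht Ds Dt Us Ut.
    rewrite (He (edge_pt L c i s)), (He (edge_pt L c i t)); try reflexivity; try assumption;
      try (apply edge_pt_points; assumption); apply H2; lra.
Qed.

(** The parity is read at the first vertex, which is never an under point; [component_parity]
    transfers it to the whole component. *)
Definition odd_component (c : nat) : bool := Z.odd (g (vtx L c 0)).

Lemma component_parity c i x : valid L c i -> on_edge L c i x -> ~ under L x ->
  Z.odd (g x) = odd_component c.
Proof.
  intros Hv [s [Hs ->]] Ux; fold (edge_pt L c i s) in *.
  rewrite edge_parity by assumption; clear s Hs Ux.
  induction i as [|i IH]; [reflexivity|].
  assert (Hw : valid L c i) by (destruct Hv; split; [assumption|lia]).
  assert (E : nxt L c i = S i) by (apply Nat.mod_small, Hv).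
  rewrite <- IH by assumption; rewrite <- E, <- edge_pt_1; apply edge_parity; [assumption|lra|].
  rewrite edge_pt_1, E; apply vtx_not_under, Hv.
Qed.

(** * The split case, where all odd arcs have color 1 *)

Section OnlyOddColorIsOne.

Hypothesis colors : forall z, color z -> Z.odd z = true -> z = 1%Z.

Lemma odd_component_color c i x : valid L c i -> odd_component c = true -> on_edge L c i x ->
  ~ under L x -> g x = 1%Z.
Proof.
  intros Hv HK Hx Ux; apply colors.
  - exists x; repeat split; try assumption; exists c, i; auto.
  - rewrite (component_parity c i); assumption.
Qed.

(** Both neighbours of the under point [k] lie on an odd component and have color 1, so the over
    color satisfies [2 * g x = 1 + 1]. *)
Lemma over_odd_component c i k x : valid L c i -> odd_component c = true -> on_edge L c i k ->
  points L x -> proj x = proj k -> pz k < pz x -> g x = 1%Z.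
Proof.
  intros Hv HK Hk Hx E Hz.
  assert (Pk : points L k) by (exists c, i; auto).
  assert (Uk : under L k) by (split; [assumption|]; exists x; auto).
  destruct (under_edge_pt k Uk) as [c' [j [r [Hw [Hr Er]]]]].
  assert (c = c') as <-.
  { apply (edge_component c i c' j k); try assumption.
    rewrite Er; apply edge_pt_on_edge; lra. }
  destruct col as [_ cr]; destruct (cr k x Pk Hx E Hz) as [e [epos He]].
  destruct (crossing_neighbours_exist c j r e Hw Hr epos)
    as [s [t [Hs [Ht [Ns [Nt [Us [Ut S]]]]]]]].
  rewrite <- Er in Ns, Nt, S.
  pose proof (He _ _ (edge_pt_points L c j s Hw Hs) (edge_pt_points L c j t Hw Ht) Ns Nt S) as Q.
  rewrite (odd_component_color c j (edge_pt L c j s)), (odd_component_color c j (edge_pt L c j t))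
    in Q by (assumption || (apply edge_pt_on_edge; assumption)).
  lia.
Qed.

(** Above the projection of [x], a point of an odd component would make [x] an under point; at the
    same height it would be [x]; below, it would force color 1 on [x]. *)
Lemma even_off_odd_components x c i : points L x -> ~ under L x -> Z.odd (g x) = false ->
  valid L c i -> odd_component c = true -> ~ on_edge2 L c i (proj x).
Proof.
  intros Hx Ux Ex Hv HK [s [Hs E]]; rewrite <- proj_edge_pt in E.
  pose proof (edge_pt_on_edge L c i s Hs) as Hon.
  destruct (Rtotal_order (pz x) (pz (edge_pt L c i s))) as [Hz|[Hz|Hz]].
  - apply Ux; split; [assumption|]; exists (edge_pt L c i s); repeat split; auto.
    apply edge_pt_points; assumption.
  - apply pt_eq in E; [|assumption]; rewrite <- E in Hon.
    rewrite (component_parity c i) in Ex by assumption; congruence.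
  - rewrite (over_odd_component c i (edge_pt L c i s) x) in Ex by assumption; discriminate.
Qed.

(* The odd components lie above all others, so they could be lifted off; the remaining
   components, colored trivially after the lift, get the colors 0 and 2 according to the
   side of the odd components on which they lie. *)
Definition lifted_coloring (x : pt) : Z :=
  if Z.odd (g x) then 1%Z else if ray_parity L odd_component (proj x) then 2%Z else 0%Z.

(** If the under strand is odd, all three colors are 1. If only the over strand is odd, the parity
    flips across it and the relation is [2 * 1 = 0 + 2]. If both are even, the parity is constant
    near the crossing. *)
Lemma lifted_coloring_valid : Zcoloring L lifted_coloring.
Proof.
  destruct col as [loc cr]; split.
  - intros x Hx Ux; destruct (loc x Hx Ux) as [e1 [e1pos H1]].
    destruct (Z.odd (g x)) eqn:Ex.
    + exists e1; split; [assumption|]; intros y Hy Uy N.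
      unfold lifted_coloring; rewrite (H1 y), Ex by assumption; reflexivity.
    + destruct (ray_parity_locally_constant L odd_component (proj x)) as [e2 [e2pos H2]].
      { intros c i Hv HK; apply even_off_odd_components; assumption. }
      assert (Hmin : 0 < Rmin e1 e2) by (apply Rmin_glb_lt; assumption).
      pose proof (Rmin_l e1 e2); pose proof (Rmin_r e1 e2).
      exists (Rmin e1 e2); split; [assumption|]; intros y Hy Uy N.
      unfold lifted_coloring.
      rewrite (H1 y), Ex, H2; try assumption; try reflexivity.
      * apply near_close; [assumption|]; apply (near_le _ _ _ (Rmin e1 e2)); [lra|assumption].
      * apply (near_le _ _ _ (Rmin e1 e2)); [lra|assumption].
  - intros q p Hq Hp E Hz.
    assert (Hu : under L q) by (split; [assumption|]; exists p; auto).
    assert (Up : ~ under L p) by (apply (over_not_under p q); assumption).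
    destruct (under_edge_pt q Hu) as [c [i [r [Hv [Hr Er]]]]].
    destruct (crossing_neighbours q c i r) as [e1 [e1pos H1]]; try assumption; [lra|].
    destruct (cr q p Hq Hp E Hz) as [e2 [e2pos H2]].
    assert (Hodd : exists e, 0 < e /\ forall s t, 0 <= s <= 1 -> 0 <= t <= 1 ->
      (s - r) * (t - r) < 0 -> ~ under L (edge_pt L c i s) -> ~ under L (edge_pt L c i t) ->
      near q (edge_pt L c i s) e -> near q (edge_pt L c i t) e ->
      (2 * g p = g (edge_pt L c i s) + g (edge_pt L c i t))%Z ->
      (2 * lifted_coloring p = lifted_coloring (edge_pt L c i s) + lifted_coloring (edge_pt L c i t))%Z).
    { destruct (odd_component c) eqn:HK; [|destruct (Z.odd (g p)) eqn:Op].
      - exists 1; split; [lra|]; intros s t Hs Ht _ Us Ut _ _ S.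
        pose proof (edge_pt_on_edge L c i s Hs); pose proof (edge_pt_on_edge L c i t Ht).
        assert (Gs : g (edge_pt L c i s) = 1%Z) by (apply (odd_component_color c i); assumption).
        assert (Gt : g (edge_pt L c i t) = 1%Z) by (apply (odd_component_color c i); assumption).
        unfold lifted_coloring; rewrite Gs, Gt in *.
        replace (g p) with 1%Z by lia; reflexivity.
      - pose proof Hp as [d [j [Hw Hon]]].
        assert (HKd : odd_component d = true) by (rewrite <- (component_parity d j p); assumption).
        pose proof Hon as [t0 [Ht0 Ep]]; fold (edge_pt L d j t0) in Ep.
        assert (Nqp : q <> p) by (intros ->; lra).
        assert (Npv : forall k, valid L d k -> p <> vtx L d k).
        { intros k Hk N; apply Nqp; rewrite N.
          destruct reg_diag as [_ [vert _]]; apply vert; [assumption..|]; congruence. }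
        assert (Ht : 0 < t0 < 1).
        { destruct (Req_dec t0 0) as [Z0|]; [|destruct (Req_dec t0 1) as [Z1|]; [|lra]].
          - subst t0; rewrite edge_pt_0 in Ep; destruct (Npv j Hw Ep).
          - subst t0; rewrite edge_pt_1 in Ep; destruct (Npv _ (valid_nxt _ _ _ Hw) Ep). }
        assert (Epq : mix t0 (vtx2 L d j) (vtx2 L d (nxt L d j)) = proj q)
          by (rewrite <- proj_edge_pt, <- Ep; assumption).
        destruct (ray_parity_flips L odd_component d j t0 Hw HKd Ht (vtx2_neq d j Hw))
          as [e [epos He]].
        (* An odd edge projecting onto the crossing passes through [p] or [q], as there are no
           triple points. Only the edge [j] of [d] passes through [p], and [q] lies on the even
           component [c]. *)
        { rewrite Epq; intros d' j' Hw' HKd' [t' [Ht' Et']]; rewrite <- proj_edge_pt in Et'.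
          pose proof (edge_pt_on_edge L d' j' t' Ht') as Hon'.
          destruct reg_diag as [triple _].
          destruct (triple (edge_pt L d' j' t') p q) as [Q|[Q|Q]]; try assumption.
          - apply edge_pt_points; assumption.
          - congruence.
          - rewrite Q, Ep in Hon'.
            apply (under_edge_unique d j d' j' t0); try assumption.
            right; exists q; rewrite <- Ep; auto.
          - destruct Nqp; symmetry; assumption.
          - rewrite Q in Hon'.
            assert (d' = c) as ->; [|congruence].
            apply (edge_component d' j' c i q); try assumption.
            rewrite Er; apply edge_pt_on_edge; lra. }
        rewrite Epq in He.
        exists e; split; [assumption|]; intros s t Hs Ht' Hst Us Ut Ns Nt S.
        (* Along the under edge, [cross] with respect to the over edge is affine in [u] and vanishes
           at [r]. The slope is [cross] at the start of the over edge translated by the direction of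
           the under edge. *)
        assert (cr_eq : forall u, cross (vtx2 L d j) (vtx2 L d (nxt L d j)) (proj (edge_pt L c i u)) =
          (u - r) * cross (vtx2 L d j) (vtx2 L d (nxt L d j))
            (fst (vtx2 L d j) + (px (vtx L c (nxt L c i)) - px (vtx L c i)),
             snd (vtx2 L d j) + (py (vtx L c (nxt L c i)) - py (vtx L c i)))).
        { intros u.
          assert (Z0 : cross (vtx2 L d j) (vtx2 L d (nxt L d j)) (proj (edge_pt L c i r)) = 0).
          { rewrite <- Er, <- Epq; unfold cross, mix; simpl; ring. }
          rewrite <- (Rminus_0_r (cross _ _ (proj _))), <- Z0.
          unfold cross, proj, edge_pt, comb, px, py; simpl; ring. }
        assert (Hne : ray_parity L odd_component (proj (edge_pt L c i s)) <>
                      ray_parity L odd_component (proj (edge_pt L c i t))).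
        { apply He; try (apply near_close; assumption).
          rewrite !cr_eq.
          (* The slope [D] is, up to form, the determinant that regularity makes nonzero. *)
          match goal with |- (_ * ?D) * (_ * ?D) < 0 => assert (HD : D <> 0) end.
          { destruct reg_diag as [_ [_ trans]].
            assert (Hon' : on_edge L c i q) by (rewrite Er; apply edge_pt_on_edge; lra).
            pose proof (trans d j c i p q Hw Hv Hon Hon' (not_eq_sym Nqp) E) as T.
            intros D0; apply T; rewrite <- D0; unfold cross, vtx2, proj; simpl; ring. }
          match goal with |- (?a * ?D) * (?b * ?D) < 0 =>
            replace ((a * D) * (b * D)) with ((a * b) * (D * D)) by ring;
            assert (0 < D * D) by (apply Rsqr_pos_lt; exact HD) end.
          nra. }
        unfold lifted_coloring.
        rewrite Op, (component_parity c i (edge_pt L c i s)),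
          (component_parity c i (edge_pt L c i t)), HK
          by (assumption || (apply edge_pt_on_edge; assumption)).
        destruct (ray_parity L odd_component (proj (edge_pt L c i s))),
          (ray_parity L odd_component (proj (edge_pt L c i t))); congruence || reflexivity.
      (* The over point [p] is even and not under, so its projection, shared with [q], avoids every
         odd component. *)
      - destruct (ray_parity_locally_constant L odd_component (proj p)) as [e [epos He]].
        { intros d j Hw HKd; apply even_off_odd_components; assumption. }
        exists e; split; [assumption|]; intros s t Hs Ht _ Us Ut Ns Nt _.
        apply near_close in Ns, Nt; try assumption; rewrite <- E in Ns, Nt.
        unfold lifted_coloring.
        rewrite Op, (component_parity c i (edge_pt L c i s)),
          (component_parity c i (edge_pt L c i t)), HK, (He _ Ns), (He _ Nt)
          by (assumption || (apply edge_pt_on_edge; assumption)).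
        destruct (ray_parity L odd_component (proj p)); reflexivity. }
    destruct Hodd as [e3 [e3pos H3]].
    pose (e := Rmin e1 (Rmin e2 e3)).
    assert (Hmin : 0 < e) by (repeat apply Rmin_glb_lt; assumption).
    assert (e <= e1 /\ e <= e2 /\ e <= e3) as [L1 [L2 L3]].
    { pose proof (Rmin_l e1 (Rmin e2 e3)); pose proof (Rmin_r e1 (Rmin e2 e3)).
      pose proof (Rmin_l e2 e3); pose proof (Rmin_r e2 e3); unfold e; repeat split; lra. }
    exists e; split; [assumption|]; intros x y Hx Hy Nx Ny S.
    assert (near_x : forall e', e <= e' -> near q x e') by (intros; apply (near_le _ _ _ e); auto).
    assert (near_y : forall e', e <= e' -> near q y e') by (intros; apply (near_le _ _ _ e); auto).
    destruct (H1 x y) as [[-> ->]|[Ux [Uy [s [t [Hs [Ht [-> [-> Hst]]]]]]]]]; auto.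
    unfold lifted_coloring; rewrite (under_color q p), E by assumption; lia.
Qed.

End OnlyOddColorIsOne.
End Coloring.
End Diagram.

(** * The possible sets of four colors *)

Lemma nodup_sublist (Q : Z -> Prop) (l : list Z) :
  exists s, NoDup s /\ forall z, In z s <-> In z l /\ Q z.
Proof.
  induction l as [|a l [s [Hs Es]]].
  - exists []; split; [constructor|]; simpl; tauto.
  - destruct (classic (Q a /\ ~ In a s)) as [[Qa Na]|N].
    + exists (a :: s); split; [constructor; assumption|].
      intros z; simpl; rewrite Es; split; [intros [<-|[? ?]]; auto|intros [[<-|?] ?]; auto].
    + exists s; split; [assumption|]; intros z; simpl; rewrite Es; split; [tauto|].
      intros [[<-|?] Qa]; [|auto].
      apply Es; apply NNPP; intros Na; apply N; auto.
Qed.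

(** [mincolZ_eq] counts the entries of an exact list of colors, so a mere upper bound on the palette
    must first be refined to one. *)
Lemma image_exists L g l : (forall z, color L g z -> In z l) ->
  exists s, image_is L g s /\ (length s <= length l)%nat.
Proof.
  intros H; destruct (nodup_sublist (color L g) l) as [s [Hs Es]].
  exists s; split.
  - split; [assumption|]; intros z; rewrite Es; split; [intros [_ Hz]; exact Hz|].
    intros Hz; split; [apply H|]; exact Hz.
  - apply NoDup_incl_length; [assumption|]; intros z Hz; apply Es, Hz.
Qed.

Lemma extract_min (n : nat) (s : list Z) : NoDup s -> length s = S n ->
  exists a t, NoDup t /\ length t = n /\ (forall z, In z t -> (a < z)%Z) /\
    forall z, In z s <-> z = a \/ In z t.
Proof.
  revert s; induction n as [|n IH]; intros [|x s] Hs Hl; try discriminate; injection Hl as Hl;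
    inversion_clear Hs as [|? ? Nx Hs'].
  - apply length_zero_iff_nil in Hl; subst s; exists x, []; split; [constructor|].
    simpl; repeat split; intuition.
  - destruct (IH s Hs' Hl) as [a [t [Ht [Lt [Min Es]]]]].
    assert (x <> a) by (intros ->; apply Nx, Es; auto).
    assert (~ In x t) by (intros N; apply Nx, Es; auto).
    destruct (Z_lt_ge_dec x a) as [Hlt|Hge].
    + exists x, (a :: t); repeat split.
      * constructor; [intros N; specialize (Min a N); lia|assumption].
      * simpl; lia.
      * intros z [<-|Hz]; [assumption|specialize (Min z Hz); lia].
      * simpl; rewrite Es; intuition.
      * simpl; rewrite Es; intuition.
    + exists a, (x :: t); repeat split.
      * constructor; assumption.
      * simpl; lia.
      * intros z [<-|Hz]; [lia|auto].
      * simpl; rewrite Es; intuition.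
      * simpl; rewrite Es; intuition.
Qed.

Lemma sorted_quadruple (s : list Z) : NoDup s -> length s = 4%nat ->
  exists a b c d : Z, (a < b)%Z /\ (b < c)%Z /\ (c < d)%Z /\
    forall z, In z s <-> (z = a \/ z = b \/ z = c \/ z = d).
Proof.
  intros Hs Hl.
  destruct (extract_min 3 s Hs Hl) as [a [s1 [Hs1 [Hl1 [M1 E1]]]]].
  destruct (extract_min 2 s1 Hs1 Hl1) as [b [s2 [Hs2 [Hl2 [M2 E2]]]]].
  destruct (extract_min 1 s2 Hs2 Hl2) as [c [s3 [Hs3 [Hl3 [M3 E3]]]]].
  destruct (extract_min 0 s3 Hs3 Hl3) as [d [s4 [Hs4 [Hl4 [M4 E4]]]]].
  apply length_zero_iff_nil in Hl4; subst s4.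
  exists a, b, c, d; repeat split.
  - apply M1, E2; auto.
  - apply M2, E3; auto.
  - apply M3, E4; auto.
  - rewrite E1, E2, E3, E4; simpl; tauto.
  - rewrite E1, E2, E3, E4; simpl; tauto.
Qed.

(** The value [vd] is the default; among the four colors only [d] receives it this way. *)
Definition table (a b c : Z) (va vb vc vd : Z) (z : Z) : Z :=
  if Z.eq_dec z a then va else if Z.eq_dec z b then vb else if Z.eq_dec z c then vc else vd.

(** * Recoloring a diagram with four colors *)

Section FourColors.

Variables (L : list (list pt)) (g : pt -> Z) (a b c d : Z).
Hypothesis link : pl_link L.
Hypothesis reg_diag : regular L.
Hypothesis col : Zcoloring L g.
Hypothesis ordered : (a < b)%Z /\ (b < c)%Z /\ (c < d)%Z.
Hypothesis colors : forall z, color L g z <-> (z = a \/ z = b \/ z = c \/ z = d).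

(** Among four increasing numbers the middle term of a nonconstant progression is [b] or [c], which
    leaves just these four possibilities. *)
Lemma table_coloring va vb vc vd :
  (2 * b = a + c -> 2 * vb = va + vc)%Z -> (2 * b = a + d -> 2 * vb = va + vd)%Z ->
  (2 * c = a + d -> 2 * vc = va + vd)%Z -> (2 * c = b + d -> 2 * vc = vb + vd)%Z ->
  Zcoloring L (fun x => table a b c va vb vc vd (g x)).
Proof.
  intros H1 H2 H3 H4; apply recoloring_valid; try assumption.
  intros u o v Hu Ho Hv; apply colors in Hu, Ho, Hv; unfold table; intros H.
  destruct Hu as [->|[->|[->| ->]]], Ho as [->|[->|[->| ->]]], Hv as [->|[->|[->| ->]]];
    repeat (destruct Z.eq_dec; try lia).
Qed.

Lemma table_colors va vb vc vd z :
  color L (fun x => table a b c va vb vc vd (g x)) z <-> (z = va \/ z = vb \/ z = vc \/ z = vd).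
Proof.
  split.
  - intros [x [_ [_ <-]]]; unfold table; repeat destruct Z.eq_dec; auto.
  - assert (Hc : forall y, y = a \/ y = b \/ y = c \/ y = d ->
      color L (fun x => table a b c va vb vc vd (g x)) (table a b c va vb vc vd y)).
    { intros y Hy; apply colors in Hy; destruct Hy as [x [Hx [Ux <-]]]; exists x; auto. }
    intros [->|[->|[->| ->]]];
      [specialize (Hc a)|specialize (Hc b)|specialize (Hc c)|specialize (Hc d)];
      unfold table in Hc at 2; repeat (destruct Z.eq_dec in Hc; try lia); auto.
Qed.

(** In either order 1 is the only odd value, so [lifted_coloring] applies. It stays nontrivial
    because an arc of value 1 keeps it, while an arc of value 0 becomes 0 or 2. *)
Lemma three_coloring_if_0124 va vb vc vd :
  Zcoloring L (fun x => table a b c va vb vc vd (g x)) ->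
  (va = 0 /\ vb = 1 /\ vc = 2 /\ vd = 4 \/ va = 4 /\ vb = 2 /\ vc = 1 /\ vd = 0)%Z ->
  exists g', Zcoloring L g' /\ nontrivial L g' /\ forall z, color L g' z -> In z [0; 1; 2]%Z.
Proof.
  intros tcol Hval; set (h := fun x => table a b c va vb vc vd (g x)) in *.
  assert (Hh : forall z, color L h z <-> (z = 0 \/ z = 1 \/ z = 2 \/ z = 4)%Z)
    by (intros z; unfold h; rewrite table_colors; lia).
  exists (lifted_coloring L h); split; [|split].
  - apply lifted_coloring_valid; try assumption.
    intros z Hz Oz; apply Hh in Hz; destruct Hz as [->|[->|[->| ->]]]; easy.
  - destruct (proj2 (Hh 1%Z)) as [x [Hx [Ux Ex]]]; [auto|].
    destruct (proj2 (Hh 0%Z)) as [y [Hy [Uy Ey]]]; [auto|].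
    exists x, y; repeat split; try assumption.
    unfold lifted_coloring; rewrite Ex, Ey; simpl.
    destruct (ray_parity L (odd_component L h) (proj y)); discriminate.
  - intros z [x [_ [_ <-]]]; unfold lifted_coloring; simpl.
    destruct (Z.odd (h x)), (ray_parity L (odd_component L h) (proj x)); auto.
Qed.

Lemma table_nontrivial va vb vc vd : (va <> vb \/ va <> vc \/ va <> vd)%Z ->
  nontrivial L (fun x => table a b c va vb vc vd (g x)).
Proof.
  intros H.
  assert (Hc := table_colors va vb vc vd).
  destruct (proj2 (Hc va)) as [x [Hx [Ux Ex]]]; [auto|].
  assert (exists w, (w = vb \/ w = vc \/ w = vd)%Z /\ va <> w) as [w [Hw N]].
  { destruct H as [H|[H|H]]; eauto. }
  destruct (proj2 (Hc w)) as [y [Hy [Uy Ey]]]; [tauto|].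
  exists x, y; repeat split; try assumption; congruence.
Qed.

Lemma four_colors_dichotomy :
  (exists g', Zcoloring L g' /\ image_is L g' [0; 1; 2; 3]%Z) \/
  (exists g', Zcoloring L g' /\ nontrivial L g' /\ forall z, color L g' z -> In z [0; 1; 2]%Z).
Proof.
  assert (two : forall va vb vc vd,
    Zcoloring L (fun x => table a b c va vb vc vd (g x)) ->
    (va <> vb \/ va <> vc \/ va <> vd)%Z ->
    (0 <= va <= 1 /\ 0 <= vb <= 1 /\ 0 <= vc <= 1 /\ 0 <= vd <= 1)%Z ->
    exists g', Zcoloring L g' /\ nontrivial L g' /\ forall z, color L g' z -> In z [0; 1; 2]%Z).
  { intros va vb vc vd Hcol N Hr; eexists; split; [exact Hcol|].
    split; [apply table_nontrivial; assumption|].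
    intros z Hz; apply table_colors in Hz; simpl; lia. }
  (* Progressions with the same middle term and one common end exclude each other. Two progressions
     give 0123, 0124 or its mirror image; in the other branches [d], [c], [b] or [a], in this order,
     lies in none, and its indicator is a coloring. *)
  destruct (Z.eq_dec (2 * b) (a + c)) as [Hac|Hac];
    [destruct (Z.eq_dec (2 * c) (b + d)) as [Hbd|Hbd];
     [|destruct (Z.eq_dec (2 * c) (a + d)) as [Had|Had]]|
     destruct (Z.eq_dec (2 * b) (a + d)) as [Had|Had];
     [destruct (Z.eq_dec (2 * c) (b + d)) as [Hbd|Hbd]|
      destruct (Z.eq_dec (2 * c) (a + d)) as [Had'|Had']]].
  - left; exists (fun x => table a b c 0 1 2 3 (g x)); split; [apply table_coloring; lia|].
    split; [repeat constructor; simpl; intuition discriminate|].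
    intros z; apply iff_sym; refine (iff_trans (table_colors 0 1 2 3 z) _).
    simpl; intuition.
  - right; apply (three_coloring_if_0124 0 1 2 4); [apply table_coloring; lia|lia].
  - right; apply (two 0 0 0 1)%Z; [apply table_coloring| |]; lia.
  - right; apply (three_coloring_if_0124 4 2 1 0); [apply table_coloring; lia|lia].
  - right; apply (two 0 0 1 0)%Z; [apply table_coloring| |]; lia.
  - right; apply (two 0 1 0 0)%Z; [apply table_coloring| |]; lia.
  - right; apply (two 1 0 0 0)%Z; [apply table_coloring| |]; lia.
Qed.

End FourColors.

Theorem theorem3p2 (L : list (list pt)) :
  pl_link L -> Zcolorable L -> mincolZ_eq L 4 ->
  exists D g, diagram_of L D /\ Zcoloring D g /\ image_is D g [0%Z; 1%Z; 2%Z; 3%Z].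
Proof.
  intros _ _ [[D [g [s [diag [col [_ [[nodup image] len]]]]]]] minimal].
  pose proof diag as [link [reg_diag _]].
  destruct (sorted_quadruple s nodup len) as [a [b [c [d [Hab [Hbc [Hcd Es]]]]]]].
  destruct (four_colors_dichotomy D g a b c d) as [[g' [col' im]]|[g' [col' [nontriv few]]]];
    try assumption.
  - auto.
  - intros z; rewrite <- Es; symmetry; apply image.
  - exists D, g'; auto.
  (* The exact palette has at most three entries on the same diagram [D], against the minimum of
     four. *)
  - exfalso; destruct (image_exists D g' _ few) as [s' [im' len']].
    pose proof (minimal D g' s' diag col' nontriv im') as Hmin; simpl in len'; lia.
Qed.
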